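(* The monoid $M_2(\mathbb{T})$ of all $2\times 2$ tropical matrices (under tropical matrix multiplication) satisfies the semigroup identity $$A^2B^4A^2\; A^2B^2\; A^2B^4A^2 \;=\; A^2B^4A^2\; B^2A^2\; A^2B^4A^2 ,$$ i.e. this equality holds for all $A,B\in M_2(\mathbb{T})$.
   Context: The tropical semiring is $\mathbb{T}=\mathbb{R}\cup\{-\infty\}$ with addition $a\oplus b=\max\{a,b\}$ and multiplication $a\odot b=a+b$ (with $-\infty$ absorbing for $\odot$). $M_2(\mathbb{T})$ is the set of $2\times 2$ matrices over $\mathbb{T}$, with matrix multiplication induced by $\oplus,\odot$; juxtaposition and powers of matrices refer to this product. A semigroup satisfies a semigroup identity $u=v$ (with $u,v$ words) if the equality holds under every substitution of semigroup elements for the letters. *)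

(* Defs.v *)
From HB Require Import structures.
From mathcomp Require Import all_boot all_order all_algebra.
From mathcomp Require Import reals.

Set Implicit Arguments.
Unset Strict Implicit.
Unset Printing Implicit Defensive.

Import Order.TTheory GRing.Theory Num.Theory.
Local Open Scope ring_scope.

(* [None] stands for -oo and [Some x] for the finite element x. *)
Definition tropical (R : Type) : Type := option R.

Section TropicalSemiring.
Variable R : realDomainType.
Implicit Types a b c : tropical R.

Definition trop_add a b : tropical R :=
  match a, b with
  | Some x, Some y => Some (Num.max x y)
  | None, _ => b
  | _, None => a
  end.

Definition trop_mul a b : tropical R :=
  match a, b with
  | Some x, Some y => Some (x + y)
  | _, _ => None
  end.

Lemma trop_addA : associative trop_add.
Proof. by move=> [x|] [y|] [z|] //=; rewrite maxA. Qed.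

Lemma trop_addC : commutative trop_add.
Proof. by move=> [x|] [y|] //=; rewrite maxC. Qed.

Lemma trop_add0 : left_id None trop_add.
Proof. by case. Qed.

Lemma trop_mulA : associative trop_mul.
Proof. by move=> [x|] [y|] [z|] //=; rewrite addrA. Qed.

Lemma trop_mulC : commutative trop_mul.
Proof. by move=> [x|] [y|] //=; rewrite addrC. Qed.

Lemma trop_mul1 : left_id (Some 0) trop_mul.
Proof. by move=> [x|] //=; rewrite add0r. Qed.

Lemma trop_mulDl : left_distributive trop_mul trop_add.
Proof. by move=> [x|] [y|] [z|] //=; rewrite addr_maxl. Qed.

Lemma trop_mul0 : left_zero None trop_mul.
Proof. by []. Qed.

HB.instance Definition _ := Choice.copy (tropical R) (option R).

HB.instance Definition _ :=
  GRing.isNmodule.Build (tropical R) trop_addA trop_addC trop_add0.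

(* In this semiring 0 is -oo, 1 is the real number 0, + is max and * is the
   addition of reals; the product and powers on ['M[tropical R]_n.+1] are
   therefore the tropical ones. *)
HB.instance Definition _ :=
  GRing.Nmodule_isComNzSemiRing.Build (tropical R)
    trop_mulA trop_mulC trop_mul1 trop_mulDl trop_mul0 isT.

End TropicalSemiring.

(* Main.v *)
Require Import Defs.
From mathcomp Require Import all_boot all_order all_algebra ring.
From mathcomp Require Import reals.

(** The argument takes place in an arbitrary commutative semiring in which
    every sum is one of its two summands; such a semiring is totally ordered
    by [x + y = y], and the tropical semiring is one.

    Put [X = A ^+ 2], [Y = B ^+ 2] and [U = X * Y ^+ 2 * X].  The claim is that
    [P = U * (X * Y) * U] and [P' = U * (Y * X) * U] agree.

    Over a commutative ring, Cayley-Hamilton gives, for 2 x 2 matrices,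
    [U * C * U = \tr (U * C) *: U - \det U *: \adj C].  Traces of 2 x 2
    matrices do not change when a word is reversed, so
    [\tr (U * (X * Y)) = \tr (U * (Y * X))], and
    [P - P' = (\det X * \det Y) ^+ 2 *: \adj (Y * X - X * Y)].
    Hence, as polynomials in the entries of [X] and [Y], the two sides only
    differ by the terms of a short explicit expression.  Moving the negative
    terms across gives an equation between polynomials with natural
    coefficients, valid in any commutative semiring ([sandwich_diag] and
    [sandwich_offdiag]).

    It remains to see that both sides absorb these correcting terms. A
    square is diagonally dominant: the product of its off-diagonal entries
    is at most that of its diagonal entries ([sqr_dominant]). Therefore
    every term in the expansion of [(\det X * \det Y) ^+ 2] is at most the
    square [d] of the product of all diagonal entries, and it is enough to
    show that [d] times each monomial of [\adj (Y * X - X * Y)], positive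
    or negative, is at most [P] and at most [P']. An entry of a product of
    matrices is at least the product of entries along any path of indices,
    and suitable paths are exhibited in [peak_diag] and [peak_offdiag].
    Most of these bounds come from one path; for the others the required
    monomial lies on the segment between the monomials of two paths, and
    is below one or the other according to which of the two diagonal
    positions is heavier. Transposition exchanges the roles of [P] and
    [P'], which halves the work. *)

Import GRing.Theory.

Set Implicit Arguments.
Unset Strict Implicit.

Local Open Scope ring_scope.

(** * The natural order of a selective semiring *)

Definition selective (S : comNzSemiRingType) : Prop :=
  forall x y : S, x + y = x \/ x + y = y.

Local Notation "x <<= y" := (x + y = y)
  (at level 70, y at next level, no associativity).

Section NaturalOrder.
Variable S : comNzSemiRingType.
Hypothesis selS : selective S.
Implicit Types x y z t : S.

Lemma nle_refl x : x <<= x.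
Proof. by case: (selS x x). Qed.

Lemma eq_nle x y z : y <<= z -> x = y -> x <<= z.
Proof. by move=> yz ->. Qed.

Lemma nle_trans y x z : x <<= y -> y <<= z -> x <<= z.
Proof. by move=> xy yz; rewrite -yz addrA xy. Qed.

Lemma nle_total x y : x <<= y \/ y <<= x.
Proof. by rewrite (addrC y); case: (selS x y); [right | left]. Qed.

Lemma nleD x y z : x <<= z -> y <<= z -> x + y <<= z.
Proof. by move=> xz yz; rewrite -addrA yz. Qed.

Lemma nle_addr x y : x <<= y + x.
Proof. by rewrite addrCA nle_refl. Qed.

Lemma nleMl x y z : x <<= y -> z * x <<= z * y.
Proof. by move=> xy; rewrite -mulrDr xy. Qed.

Lemma nleM x y z t : x <<= y -> z <<= t -> x * z <<= y * t.
Proof.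
move=> xy zt; apply: (@nle_trans (x * t)); first exact: nleMl.
by rewrite ![_ * t]mulrC; apply: nleMl.
Qed.

Lemma nle_absorb x y z : y <<= x -> z <<= x -> x + y + z = x.
Proof. by move=> yx zx; rewrite -addrA addrC nleD. Qed.

(** Convexity for the two monomials [w * a ^+ 3] and [w * b ^+ 3]: in a total
    order, a monomial on the segment joining them is below the larger one. *)
Lemma nle_segment w a b z :
  w * a ^+ 3 <<= z -> w * b ^+ 3 <<= z -> w * (a * b ^+ 2) <<= z.
Proof.
move=> az bz; case: (nle_total a b) => ab.
  by apply: nle_trans bz; rewrite [b ^+ 3]exprS; apply/nleMl/nleM/nle_refl.
apply: nle_trans az; rewrite [a ^+ 3]exprS.
by apply/nleMl/nleMl/nleM.
Qed.

End NaturalOrder.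

(** * Products of 2 x 2 matrices *)

Section Matrices.
Variable S : comNzSemiRingType.
Implicit Types (M N X Y Z T : 'M[S]_2) (i j k l : 'I_2).

Lemma mul_mx2 i j M N k l : i != j ->
  (M * N) k l = M k i * N i l + M k j * N j l.
Proof.
move=> nij; rewrite mxE (bigD1 i) //= (bigD1 j) 1?eq_sym //= big1 ?addr0 //.
move=> m /andP[mi mj]; exfalso; move: nij mi mj.
by case: i => -[|[|i]] // ?; case: j => -[|[|j]] // ?; case: m => -[|[|m]].
Qed.

Lemma tr_mulmx2 M N : (M * N)^T = N^T * M^T.
Proof.
apply/matrixP=> k l; rewrite !mxE; apply: eq_bigr => m _.
by rewrite !mxE mulrC.
Qed.

Definition sandwich X Y M : 'M[S]_2 :=
  (X * (Y * Y) * X) * M * (X * (Y * Y) * X).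

Lemma tr_sandwich X Y M : (sandwich X Y M)^T = sandwich X^T Y^T M^T.
Proof. by rewrite /sandwich !tr_mulmx2 !mulrA. Qed.

(** The positive and the negative terms of [(\det M) ^+ 2]. *)
Definition sqdet_pos M i j := (M i i * M j j) ^+ 2 + (M i j * M j i) ^+ 2.
Definition sqdet_neg M i j := (M i i * M j j * (M i j * M j i)) *+ 2.

(** The positive and the negative terms of [(\det X * \det Y) ^+ 2]. *)
Definition sqdet2_pos X Y i j :=
  sqdet_pos X i j * sqdet_pos Y i j + sqdet_neg X i j * sqdet_neg Y i j.
Definition sqdet2_neg X Y i j :=
  sqdet_pos X i j * sqdet_neg Y i j + sqdet_neg X i j * sqdet_pos Y i j.

(** The diagonal part of
    [P - P' = (\det X * \det Y) ^+ 2 *: \adj (Y * X - X * Y)], without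
    subtraction. *)
Lemma sandwich_diag X Y i j : i != j ->
  sandwich X Y (X * Y) i i
    + sqdet2_pos X Y i j * (Y i j * X j i)
    + sqdet2_neg X Y i j * (X i j * Y j i) =
  sandwich X Y (Y * X) i i
    + sqdet2_pos X Y i j * (X i j * Y j i)
    + sqdet2_neg X Y i j * (Y i j * X j i).
Proof.
move=> nij; rewrite /sandwich !(mul_mx2 _ _ _ _ nij).
rewrite /sqdet2_pos /sqdet2_neg /sqdet_pos /sqdet_neg.
ring.
Qed.

Lemma sandwich_offdiag X Y i j : i != j ->
  sandwich X Y (X * Y) i j
    + sqdet2_pos X Y i j * (Y i i * X i j + Y i j * X j j)
    + sqdet2_neg X Y i j * (X i i * Y i j + X i j * Y j j) =
  sandwich X Y (Y * X) i j
    + sqdet2_pos X Y i j * (X i i * Y i j + X i j * Y j j)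
    + sqdet2_neg X Y i j * (Y i i * X i j + Y i j * X j j).
Proof.
move=> nij; rewrite /sandwich !(mul_mx2 _ _ _ _ nij).
rewrite /sqdet2_pos /sqdet2_neg /sqdet_pos /sqdet_neg.
ring.
Qed.

(** * Absorbing the correcting terms *)

Hypothesis selS : selective S.

Lemma mul_entry_nle M N i k j x y :
  x <<= M i k -> y <<= N k j -> x * y <<= (M * N) i j.
Proof.
move=> xM yN; apply: (nle_trans (nleM xM yN)).
by rewrite mxE (bigD1 k) //= addrC; apply: nle_addr.
Qed.

Lemma path_nle X Y Z T i a b c d e f g h k j :
  X i a * (Y a b * Y b c) * X c d * (Z d e * T e f)
    * (X f g * (Y g h * Y h k) * X k j)
  <<= sandwich X Y (Z * T) i j.
Proof. by do !apply: mul_entry_nle; apply: nle_refl. Qed.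

(** An upper bound for the terms of [(\det X * \det Y) ^+ 2] when [X] and [Y]
    are diagonally dominant. *)
Definition peak X Y i j := (X i i * X j j * (Y i i * Y j j)) ^+ 2.

(** One path each: an excursion from [i] to [j] and back, long enough to
    use each of [X j j] and [Y j j] exactly twice. *)
Lemma peak_diag X Y i j :
  peak X Y i j * (X i j * Y j i) <<= sandwich X Y (X * Y) i i /\
  peak X Y i j * (Y i j * X j i) <<= sandwich X Y (X * Y) i i.
Proof.
split.
- apply: eq_nle (path_nle X Y X Y i j j j j j i i i i i) _.
  by rewrite /peak; ring.
- apply: eq_nle (path_nle X Y X Y i i j j j j j i i i i) _.
  by rewrite /peak; ring.
Qed.

(** In the word [X Y Y X (X Y) X Y Y X] the third occurrence of either letter
    has exactly two occurrences of that letter on each side.  Crossing from [i]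
    to [j] there handles [X i j * Y j j] and [X i i * Y i j]; the other two
    monomials are one third of the way between two crossings. *)
Lemma peak_offdiag X Y i j :
  [/\ peak X Y i j * (X i i * Y i j) <<= sandwich X Y (X * Y) i j,
      peak X Y i j * (X i j * Y j j) <<= sandwich X Y (X * Y) i j,
      peak X Y i j * (Y i i * X i j) <<= sandwich X Y (X * Y) i j &
      peak X Y i j * (Y i j * X j j) <<= sandwich X Y (X * Y) i j].
Proof.
pose a := X i i * Y i i; pose b := X j j * Y j j.
split.
- apply: eq_nle (path_nle X Y X Y i i i i i i j j j j j) _.
  by rewrite /peak; ring.
- apply: eq_nle (path_nle X Y X Y i i i i i j j j j j j) _.
  by rewrite /peak; ring.
- have -> : peak X Y i j * (Y i i * X i j) =
            X i j * X i i * Y i i ^+ 2 * (a * b ^+ 2).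
    by rewrite /peak /a /b; ring.
  apply: nle_segment => //.
  + apply: eq_nle (path_nle X Y X Y i i i i i i i i i i j) _.
    by rewrite /a; ring.
  + apply: eq_nle (path_nle X Y X Y i i i i j j j j j j j) _.
    by rewrite /b; ring.
- have -> : peak X Y i j * (Y i j * X j j) =
            X i i * Y i i * X j j * Y i j * (a * b ^+ 2).
    by rewrite /peak /a /b; ring.
  apply: nle_segment => //.
  + apply: eq_nle (path_nle X Y X Y i i i i i i i i i j j) _.
    by rewrite /a; ring.
  + apply: eq_nle (path_nle X Y X Y i i i j j j j j j j j) _.
    by rewrite /b; ring.
Qed.

(** Transposition exchanges the two sides of the identity, so that the bounds
    on one side give those on the other. *)
Lemma sandwich_tr X Y k l :
  sandwich X Y (Y * X) k l = sandwich X^T Y^T (X^T * Y^T) l k.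
Proof. by rewrite -tr_mulmx2 -tr_sandwich [RHS]mxE. Qed.

Lemma peak_tr X Y i j : peak X^T Y^T i j = peak X Y i j.
Proof. by rewrite /peak !mxE. Qed.

Lemma peakC X Y i j : peak X Y i j = peak X Y j i.
Proof. by rewrite /peak; ring. Qed.

(** Equivalently, the two terms of the permanent of [M] add up to the diagonal
    one. *)
Definition dominant M i j := M i j * M j i <<= M i i * M j j.

Lemma sqdet_peak X i j : dominant X i j ->
  sqdet_pos X i j <<= (X i i * X j j) ^+ 2 /\
  sqdet_neg X i j <<= (X i i * X j j) ^+ 2.
Proof.
move=> domX; have diag_refl := nle_refl selS (X i i * X j j); split.
- by apply: nleD; [apply: nle_refl | apply: nleM].
- by rewrite /sqdet_neg mulr2n; apply: nleD; apply: nleM.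
Qed.

Lemma sqdet2_peak X Y i j : dominant X i j -> dominant Y i j ->
  sqdet2_pos X Y i j <<= peak X Y i j /\ sqdet2_neg X Y i j <<= peak X Y i j.
Proof.
move=> /sqdet_peak[posX negX] /sqdet_peak[posY negY].
by rewrite /peak exprMn; split; apply: nleD; apply: nleM.
Qed.

Lemma sandwich_swap X Y :
    (forall i j, i != j -> dominant X i j) ->
    (forall i j, i != j -> dominant Y i j) ->
  sandwich X Y (X * Y) = sandwich X Y (Y * X).
Proof.
move=> domX domY.
have absorb i j u v P : i != j ->
    peak X Y i j * u <<= P -> peak X Y i j * v <<= P ->
    P + sqdet2_pos X Y i j * u + sqdet2_neg X Y i j * v = P.
  move=> nij uP vP.
  have [pos_peak neg_peak] := sqdet2_peak (domX i j nij) (domY i j nij).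
  by apply: nle_absorb; [move: uP | move: vP]; apply: nle_trans;
     apply: nleM => //; apply: nle_refl.
apply/matrixP=> k l; have [<-{l} | nkl] := eqVneq k l.
  have [j nkj] : exists j, k != j.
    by exists (if k == 0 then 1 else 0); case: ifP => [/eqP->|/negbT].
  have := sandwich_diag X Y nkj.
  have [P1 P2] := peak_diag X Y k j.
  have [] := peak_diag X^T Y^T k j; rewrite -sandwich_tr peak_tr.
  rewrite ![_^T _ _]mxE => Q1 Q2.
  by rewrite !absorb // [X in _ * X]mulrC.
have := sandwich_offdiag X Y nkl.
have [P1 P2 P3 P4] := peak_offdiag X Y k l.
have [] := peak_offdiag X^T Y^T l k; rewrite -sandwich_tr.
rewrite peak_tr peakC ![_^T _ _]mxE => Q1 Q2 Q3 Q4.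
by rewrite !absorb ?mulrDr //; apply: nleD; rewrite // [X in _ * X]mulrC.
Qed.

End Matrices.

(** * Squares and the tropical semiring *)

(** Writing [a], [b], [c], [d] for the entries of [A], the product of the
    off-diagonal entries of [A ^+ 2] is [b * c * (a + d) ^+ 2]; its only term
    that is not already in the product of the diagonal entries is
    [b * c * (a * d)], which lies between [b * c * a ^+ 2] and
    [b * c * d ^+ 2]. *)
Lemma sqr_dominant (S : comNzSemiRingType) (A : 'M[S]_2) i j :
  selective S -> i != j -> dominant (A ^+ 2) i j.
Proof.
move=> selS nij; rewrite /dominant expr2 !(mul_mx2 _ _ _ _ nij).
set a := A i i; set b := A i j; set c := A j i; set d := A j j.
set rhs := (a * a + b * c) * (c * b + d * d).
have aa : b * c * (a * a) <<= rhs.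
  have -> : rhs = (b * c * (b * c) + a * a * (d * d) + b * c * (d * d))
                  + b * c * (a * a) by rewrite /rhs; ring.
  exact: nle_addr.
have dd : b * c * (d * d) <<= rhs.
  have -> : rhs = (b * c * (b * c) + a * a * (d * d) + b * c * (a * a))
                  + b * c * (d * d) by rewrite /rhs; ring.
  exact: nle_addr.
have ad : b * c * (a * d) <<= rhs.
  have [le_ad | le_da] := nle_total selS a d.
  - by apply: nle_trans dd; apply/nleMl/nleM/nle_refl.
  - by apply: nle_trans aa; apply/nleMl/nleM/le_da/nle_refl.
have -> : (a * b + b * d) * (c * a + d * c) =
  b * c * (a * a) + b * c * (d * d) + (b * c * (a * d) + b * c * (a * d)).
  by ring.
by do !apply: nleD.
Qed.

Lemma tropical_selective (R : realDomainType) : selective (tropical R).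
Proof.
move=> [x|] [y|]; [|by left|by right|by left].
rewrite /GRing.add /=; case: (Order.TotalTheory.leP x y) => _.
  by right.
by left.
Qed.

Unset Implicit Arguments.

Theorem theorem3p9 (R : realType) (A B : 'M[tropical R]_2) :
  (A ^+ 2 * B ^+ 4 * A ^+ 2) * (A ^+ 2 * B ^+ 2) * (A ^+ 2 * B ^+ 4 * A ^+ 2) =
  (A ^+ 2 * B ^+ 4 * A ^+ 2) * (B ^+ 2 * A ^+ 2) * (A ^+ 2 * B ^+ 4 * A ^+ 2).
Proof.
rewrite [B ^+ 4](exprD B 2 2).
have selR := @tropical_selective R.
by apply: sandwich_swap => // i j nij; apply: sqr_dominant.
Qed.
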